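(* Let $l\in\{0,1\}$. Suppose the randomized classifiers $\{Q_i\}$ have the form $Q_i(x)=g(x,\mathcal{D},\xi_i)$ (for all $x\in\mathcal{X}$) with $g$ deterministic and $\xi_1,\xi_2,\dots$ i.i.d. and independent of $\mathcal{D}$. Suppose also that for each $l'\in\{0,1\}$ the conditional distribution $\mathcal{L}(\theta(X)\mid\mathcal{D},Y=l')$ has a density $f_{l'}$ on $[0,1]$ that is Lipschitz in a neighborhood of $1/2$. Then, as $t\to\infty$ along odd integers, $$\operatorname{var}(\mathrm{Err}_{t,l}\mid\mathcal{D})\;\le\;\frac{1}{4t}\,\big[f_l(\tfrac12)\big]^2+o\big(\tfrac1t\big).$$
   Context: $\mathcal{X}$ is a generic sample space; $\mathcal{D}=\{(X_j,Y_j)\}_{j=1}^n$ is a training set in $\mathcal{X}\times\{0,1\}$, which is held fixed (all expectations and variances are conditional on $\mathcal{D}$, and implied constants and $o(\cdot)$ terms may depend on $\mathcal{D}$). $(X,Y)$ is a random test point in $\mathcal{X}\times\{0,1\}$, independent of $\mathcal{D}$ and of $\xi_1,\xi_2,\dots$; $\mu_l:=\mathcal{L}(X\mid Y=l)$ is the distribution of $X$ given $Y=l$. The classifiers are random functions $Q_i:\mathcal{X}\to\{0,1\}$, $\bar Q_t(x):=\frac1t\sum_{i=1}^tQ_i(x)$, and $t$ is odd. The class-wise error rate of the majority vote is the random variable $$\mathrm{Err}_{t,l}:=\int_{\mathcal{X}}1\{|\bar Q_t(x)-l|\ge\tfrac12\}\,d\mu_l(x).$$ Define $\theta:\mathcal{X}\to[0,1]$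 by $\theta(x):=\mathbb{E}[Q_1(x)\mid\mathcal{D}]$, the expectation being over $\xi_1$ with $x$ and $\mathcal{D}$ fixed. Also $\operatorname{var}(\mathrm{Err}_{t,l}\mid\mathcal{D}):=\mathbb{E}[\mathrm{Err}_{t,l}^2\mid\mathcal{D}]-(\mathbb{E}[\mathrm{Err}_{t,l}\mid\mathcal{D}])^2$. A function $q:[0,1]\to\mathbb{R}$ is Lipschitz in a neighborhood of $1/2$ if there are constants $\kappa,\delta>0$ with $|q(s)-q(s')|\le\kappa|s-s'|$ for all $s,s'\in[1/2-\delta,1/2+\delta]$. *)

(* Defs.v *)
From HB Require Import structures.
From mathcomp Require Import all_boot all_order all_algebra.
From mathcomp Require Import all_classical all_reals all_analysis.

Set Implicit Arguments.
Unset Strict Implicit.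
Unset Printing Implicit Defensive.
Import Order.TTheory GRing.Theory Num.Theory.
Import numFieldNormedType.Exports.

Local Open Scope classical_set_scope.
Local Open Scope ring_scope.

Section Independence.
Context d (Omega : measurableType d) (R : realType) (P : probability Omega R).

Definition indep_systems (F G : set_system Omega) : Prop :=
  forall A B, F A -> G B -> (P (A `&` B) = P A * P B)%E.

Definition mutually_independent d' (S : measurableType d')
    (xi : nat -> Omega -> S) : Prop :=
  forall (s : seq nat) (A : nat -> set S), uniq s ->
    (forall i, measurable (A i)) ->
    (P (\bigcap_(i in [set` s]) (xi i @^-1` A i)) =
     \prod_(i <- s) P (xi i @^-1` A i))%E.

Definition identically_distributed d' (S : measurableType d')
    (xi : nat -> Omega -> S) : Prop :=
  forall i j (A : set S), measurable A ->
    P (xi i @^-1` A) = P (xi j @^-1` A).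

Definition sigma_of d' (S : measurableType d') (Z : Omega -> S) :
    set_system Omega :=
  preimage_set_system setT Z measurable.

Definition sigma_of_seq d' (S : measurableType d') (xi : nat -> Omega -> S) :
    set_system Omega :=
  <<s \bigcup_i sigma_of (xi i) >>.

End Independence.

Section Conditioning.
Context d (Omega : measurableType d) (R : realType) (P : probability Omega R).

Lemma measurable_label (Y : {RV P >-> bool}) (l : bool) :
  measurable (Y @^-1` [set l]).
Proof. by rewrite -[X in measurable X]setTI; exact: measurable_funP. Qed.

(* P(. | Y = l), that is A |-> P(A /\ Y = l) / P(Y = l) when P(Y = l) > 0; the
   second argument of mnormalize is a junk value, used only if P(Y = l) = 0. *)
Definition cond_prob (Y : {RV P >-> bool}) (l : bool) : probability Omega R :=
  mnormalize (mrestr P (measurable_label Y l)) P.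

Definition cond_law d' (T : measurableType d') (X : {RV P >-> T})
    (Y : {RV P >-> bool}) (l : bool) : probability T R :=
  distribution (cond_prob Y l) X.

End Conditioning.

Section Densities.
Context (R : realType).

(* Only the values of q and f on [0, 1] are constrained. *)
Definition lipschitz_near_half (q : R -> R) : Prop :=
  exists kappa delta : R, [/\ 0 < kappa, 0 < delta &
    forall s s' : R, 0 <= s <= 1 -> 0 <= s' <= 1 ->
      2^-1 - delta <= s <= 2^-1 + delta ->
      2^-1 - delta <= s' <= 2^-1 + delta ->
      `|q s - q s'| <= kappa * `|s - s'|].

Definition has_density01 (nu : set R -> \bar R) (f : R -> R) : Prop :=
  [/\ measurable_fun (`[0, 1] : set R) f,
      forall s, 0 <= s <= 1 -> 0 <= f s &
      forall B : set R, measurable B ->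
        (nu B = \int[lebesgue_measure]_(s in B `&` `[0%R, 1%R]) (f s)%:E)%E].

End Densities.

Section MajorityVote.
Context d (Omega : measurableType d) (R : realType) (P : probability Omega R).
Context d' (T : measurableType d') (Q : nat -> Omega -> T -> bool).

(* The training set is a fixed parameter hidden in Q, so expectations under P
   play the role of conditional expectations given the training set.
   Indices start at 0: Q 0, Q 1, ... stand for Q_1, Q_2, ... *)
Definition Qbar (t : nat) (w : Omega) (x : T) : R :=
  t%:R^-1 * \sum_(i < t) (Q i w x)%:R.

Definition theta (x : T) : R := fine 'E_P[fun w => (Q 0 w x)%:R].

Definition Err (mu : probability T R) (l : bool) (t : nat) (w : Omega) : R :=
  \int[mu]_x \1_[set x | `|Qbar t w x - l%:R| >= 2^-1] x.

Definition var (Z : Omega -> R) : R :=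
  fine 'E_P[fun w => Z w ^+ 2] - fine 'E_P[Z] ^+ 2.

End MajorityVote.

(* Main.v *)
Require Import Defs.
From HB Require Import structures.
From mathcomp Require Import all_boot all_order all_algebra.
From mathcomp Require Import all_classical all_reals all_analysis.
From mathcomp Require Import ring lra zify.
From mathcomp Require Import measurable_realfun.
Set Implicit Arguments.
Unset Strict Implicit.
Unset Printing Implicit Defensive.
Import Order.TTheory GRing.Theory Num.Theory.
Import numFieldNormedType.Exports.
Local Open Scope classical_set_scope.
Local Open Scope ring_scope.

(** Write [t = 2 m + 1] and let [B(s)] be the probability that more than half
    of [t] independent Bernoulli([s]) votes equal 1. The majority at [x] is 1
    with probability [B(theta x)], and the error rate is, up to replacing
    [Z] by [1 - Z], the [mu_l]-measure [Z] of the random set [S_w] of points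
    where the majority is 1.

    Integrating [Z ^ 2] and exchanging integrals,
      [E Z^2 = int int P(x and x' both in S_w) d mu_l(x) d mu_l(x')],
    and the inner probability is at most the smaller of [B(theta x)] and
    [B(theta x')], while [E Z = int B(theta x) d mu_l(x)] does not see the
    joint law of the votes. So the variance can only grow if the votes are
    replaced by perfectly nested ones with the same marginals
    ([var_xsection_le]). The nested model is explicit: [B] is the distribution
    function of the median [V] of [t] uniform variables, which has the law
    Beta(m+1, m+1) ([few_failures_beta]), and the nested random set is
    [{x | V <= theta x}], whose measure is [G(V)], with [G] the survival
    function of [theta X] given [Y = l] ([var_majority_le]).

    What remains is a delta method for [G(V)]. As [f_l] is Lipschitz near 1/2,
      [|G(v) - G(1/2)| <= f_l(1/2) |v - 1/2| + K (v - 1/2)^2]  for every [v]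
    ([tail_expansion]): near 1/2 by integrating the density, away from 1/2
    because [G] takes values between 0 and 1. The variance of [G(V)] is at most
    [E (G(V) - G(1/2))^2], and the moments
      [E (V - 1/2)^2 = 1 / (4 (t + 2))],
      [E (V - 1/2)^4 = 3 / (16 (t + 2) (t + 4))]
    give the leading term [f_l(1/2)^2 / (4 t)]. Separating the two parts of the
    expansion by [(a + b)^2 <= (1 + eta) a^2 + (1 + 1/eta) b^2] with
    [eta = t ^ (-1/2)] leaves an error of order [t ^ (-3/2)]. *)

(** * Sections of a random set and the nested coupling *)

Section UnitBoundedIntegrals.
Context d (Omega : measurableType d) (R : realType) (P : probability Omega R).

Lemma varE (Z : Omega -> R) :
  var P Z = \int[P]_w (Z w ^+ 2) - (\int[P]_w Z w) ^+ 2.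
Proof. by rewrite /var unlock. Qed.

Lemma integrable_le1 (Z : Omega -> R) : measurable_fun setT Z ->
  (forall w, `|Z w| <= 1) -> P.-integrable setT (EFin \o Z).
Proof.
move=> mZ Z1; apply: measurable_bounded_integrable => //.
  by rewrite -ge0_fin_numE// fin_num_measure.
by exists 1; split => // M M1 w _; exact: le_trans (Z1 w) (ltW M1).
Qed.

Lemma fine_probability_itv (A : set Omega) : measurable A ->
  0 <= fine (P A) <= 1.
Proof.
move=> mA; have fA := fin_num_measure P A mA.
by rewrite -!lee_fin fineK// measure_ge0 probability_le1.
Qed.

End UnitBoundedIntegrals.

Section FiberSquare.
Context d (U : measurableType d) d' (T : measurableType d').
Implicit Types D : set (U * T).

(** Turns the second moment of the measure of a section of [D] into a first
    moment: its sections are [A * A] in one direction, where [A] is a section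
    of [D], and intersections of two sections of [D] in the other. *)
Definition fiber_square D : set (U * (T * T)) :=
  ((fun p => (p.1, p.2.1)) @^-1` D) `&` ((fun p => (p.1, p.2.2)) @^-1` D).

Lemma measurable_fiber_square D : measurable D -> measurable (fiber_square D).
Proof.
move=> mD; apply: measurableI; rewrite -[X in measurable X]setTI;
  by apply: measurable_fun_pair => //; exact: measurableT_comp.
Qed.

Lemma xsection_fiber_square D u :
  xsection (fiber_square D) u = xsection D u `*` xsection D u.
Proof. by apply/seteqP; split => -[x y]; rewrite !xsectionE. Qed.

Lemma ysection_fiber_square D z :
  ysection (fiber_square D) z = ysection D z.1 `&` ysection D z.2.
Proof. by apply/seteqP; split => u; rewrite !ysectionE. Qed.

End FiberSquare.

Section SectionMoments.
Context d (Omega : measurableType d) (R : realType) (P : probability Omega R).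
Context d' (T : measurableType d').

Lemma measurable_fine_xsection (mu : probability T R) (S : set (Omega * T)) :
  measurable S -> measurable_fun setT (fun w => fine (mu (xsection S w))).
Proof.
move=> mS.
exact: measurableT_comp (fine_measurable measurableT)
  (measurable_fun_xsection mu mS).
Qed.

Lemma measurable_fine_ysection (S : set (Omega * T)) :
  measurable S -> measurable_fun setT (fun x => fine (P (ysection S x))).
Proof.
move=> mS.
exact: measurableT_comp (fine_measurable measurableT)
  (measurable_fun_ysection P mS).
Qed.

Lemma integrable_fine_ysection (mu : probability T R) (S : set (Omega * T)) :
  measurable S ->
  mu.-integrable setT (EFin \o (fun x => fine (P (ysection S x)))).
Proof.
move=> mS; apply: integrable_le1 => [|x]; first exact: measurable_fine_ysection.
have /(fine_probability_itv P)/andP[? ?] : measurable (ysection S x).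
  exact: measurable_ysection.
by rewrite ger0_norm.
Qed.

(** The two iterated integrals of an indicator agree because the product
    measure is unique. *)
Lemma Rintegral_xsection (mu : probability T R) (S : set (Omega * T)) :
  measurable S ->
  \int[P]_w fine (mu (xsection S w)) = \int[mu]_x fine (P (ysection S x)).
Proof.
move=> mS; have finx w : mu (xsection S w) \is a fin_num.
  by apply: fin_num_measure; exact: measurable_xsection.
have finy x : P (ysection S x) \is a fin_num.
  by apply: fin_num_measure; exact: measurable_ysection.
rewrite /Rintegral; congr fine.
under eq_integral do rewrite fineK//.
under [RHS]eq_integral do rewrite fineK//.
apply: (@product_measure_unique _ _ _ _ _ P mu (P \x^ mu)%E) => //.
exact: product_measure2E.
Qed.

End SectionMoments.

Lemma Rintegral_xsection_sqr d (Omega : measurableType d) d'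
    (T : measurableType d') (R : realType) (P : probability Omega R)
    (mu : probability T R) (S : set (Omega * T)) : measurable S ->
  \int[P]_w (fine (mu (xsection S w)) ^+ 2) =
  \int[(mu \x mu)%E]_z fine (P (ysection (fiber_square S) z)).
Proof.
move=> mS; rewrite -Rintegral_xsection; last exact: measurable_fiber_square.
apply: eq_Rintegral => w _.
have mSw : measurable (xsection S w) by exact: measurable_xsection.
have fSw := fin_num_measure mu _ mSw.
rewrite xsection_fiber_square expr2 -fineM//; congr fine.
exact/esym/product_measure1E.
Qed.

(** Nested sections maximize the variance of the measure of a random set with
    prescribed marginals: the mean depends on the marginals only, and a joint
    probability is bounded by the smaller marginal, a bound attained when the
    events are nested. *)
Lemma var_xsection_le d (Omega : measurableType d) d' (V : measurableType d')
    d'' (T : measurableType d'') (R : realType) (P : probability Omega R)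
    (nu : probability V R) (mu : probability T R)
    (S : set (Omega * T)) (C : set (V * T)) :
  measurable S -> measurable C ->
  (forall x, P (ysection S x) = nu (ysection C x)) ->
  (forall x x', ysection C x `<=` ysection C x' \/
                ysection C x' `<=` ysection C x) ->
  var P (fun w => fine (mu (xsection S w))) <=
  var nu (fun v => fine (mu (xsection C v))).
Proof.
move=> mS mC PC nested; rewrite !varE !Rintegral_xsection_sqr//.
rewrite !Rintegral_xsection//.
under [in X in _ - X <= _]eq_Rintegral do rewrite PC.
apply: lerB => //; apply: le_Rintegral => //.
- by apply: integrable_fine_ysection; exact: measurable_fiber_square.
- by apply: integrable_fine_ysection; exact: measurable_fiber_square.
move=> [x y] _; rewrite !ysection_fiber_square/=.
have mSx z : measurable (ysection S z) by exact: measurable_ysection.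
have mCx z : measurable (ysection C z) by exact: measurable_ysection.
apply: fine_le; rewrite ?fin_num_measure//; try exact: measurableI.
have [sub|sub] := nested x y.
  rewrite (setIidl sub) -PC; apply: le_measure; rewrite ?inE//.
  exact: measurableI.
rewrite (setIidr sub) -PC; apply: le_measure; rewrite ?inE//.
exact: measurableI.
Qed.

(** * Variance of a variable with values in the unit interval *)

Lemma Rintegral_cst_probability d (Omega : measurableType d) (R : realType)
  (P : probability Omega R) (k : R) : \int[P]_w k = k.
Proof.
rewrite Rintegral_cst// -[RHS]mulr1; congr (_ * _).
exact: (congr1 fine (probability_setT P)).
Qed.

Section Variance.
Context d (Omega : measurableType d) (R : realType) (P : probability Omega R).
Variable Z : Omega -> R.
Hypotheses (mZ : measurable_fun setT Z) (Z01 : forall w, 0 <= Z w <= 1).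

Let iZ : P.-integrable setT (EFin \o Z).
Proof.
by apply: integrable_le1 => // w; have /andP[? ?] := Z01 w; rewrite ger0_norm.
Qed.

Let iZ2 : P.-integrable setT (EFin \o (fun w => Z w ^+ 2)).
Proof.
apply: integrable_le1 => [|w]; first exact: measurable_funX.
have /andP[? ?] := Z01 w.
by rewrite ger0_norm ?exprn_ge0// exprn_ile1.
Qed.

Lemma Rintegral_sqrB (c : R) :
  \int[P]_w ((Z w - c) ^+ 2) =
  \int[P]_w (Z w ^+ 2) - c *+ 2 * \int[P]_w Z w + c ^+ 2.
Proof.
have icst (k : R) : P.-integrable setT (EFin \o (fun=> k)).
  exact: finite_measure_integrable_cst.
have iZc : P.-integrable setT (EFin \o (fun w => c *+ 2 * Z w)).
  rewrite [X in integrable _ _ X](_ : _ =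
    (fun w => (c *+ 2)%:E * (EFin \o Z) w)%E).
    exact: integrableZl.
  by apply/funext => w /=; rewrite EFinM.
have -> : c ^+ 2 = \int[P]_w (c ^+ 2).
  by rewrite Rintegral_cst_probability.
rewrite -RintegralZl// -RintegralB// -RintegralD//; last first.
  rewrite [X in integrable _ _ X](_ : _ =
    ((EFin \o (fun w => Z w ^+ 2)%R) \- (EFin \o (fun w => c *+ 2 * Z w)%R))%E).
    exact: integrableB.
  by apply/funext => w /=; rewrite EFinB.
by apply: eq_Rintegral => w _; ring.
Qed.

Lemma var_le_sqrB (c : R) : var P Z <= \int[P]_w ((Z w - c) ^+ 2).
Proof.
rewrite varE Rintegral_sqrB -subr_ge0.
rewrite (_ : _ - _ = (\int[P]_w Z w - c) ^+ 2) ?sqr_ge0//.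
by ring.
Qed.

Lemma var_onem : var P (fun w => 1 - Z w) = var P Z.
Proof.
rewrite !varE.
have -> : \int[P]_w (1 - Z w) = 1 - \int[P]_w Z w.
  rewrite RintegralB//; last exact: finite_measure_integrable_cst.
  by rewrite Rintegral_cst_probability.
under eq_Rintegral => w _ do rewrite -sqrrN opprB.
by rewrite Rintegral_sqrB; lra.
Qed.

End Variance.

(** * Central moments of the symmetric Beta law *)

Section BetaMoments.
Context {R : realType}.

Lemma Rintegral_beta_XMonemX a b c :
  \int[beta_prob a.+1 b.+1]_(x in `[0, 1]) XMonemX c c x =
  beta_fun (a + c).+1 (b + c).+1 / beta_fun a.+1 b.+1 :> R.
Proof.
rewrite /Rintegral integral_beta_prob//; first last.
- by have /integrableP[] := @beta_prob_integrable R a.+1 b.+1 c c.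
- by apply/measurable_EFinP; exact: measurable_XMonemX.
transitivity (\int[lebesgue_measure]_(x in `[0, 1])
    ((beta_fun a.+1 b.+1)^-1 * XMonemX (a + c) (b + c) x) : R).
  congr fine; apply: eq_integral => x x01.
  rewrite -EFinM /beta_pdf patchE x01/= mulrA mulrC; congr (_ * _)%:E.
  by rewrite /XMonemX !exprD; ring.
rewrite RintegralZl//; last exact: integrable_XMonemX.
by rewrite mulrC [in LHS]Rintegral_mkcond.
Qed.

Lemma beta_funSS m : beta_fun m.+2 m.+2 / beta_fun m.+1 m.+1 =
  m.+1%:R / (2 * (2 * m + 3)%:R) :> R.
Proof.
rewrite !beta_fun_fact.
have -> : (m.+1 + m.+1).+1 = (m + m).+3 by rewrite addSn addnS.
rewrite !factS !natrM !natrD.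
have f0 n : n`!%:R != 0 :> R by rewrite pnatr_eq0 -lt0n fact_gt0.
have n0 : 0 <= m%:R :> R by [].
rewrite -!natr1 !natrD; field.
by rewrite !f0 /=; apply/and3P; split; apply/eqP; lra.
Qed.

Let iXX m c :
  (@beta_prob R m.+1 m.+1).-integrable `[0, 1] (EFin \o XMonemX c c).
Proof. exact: beta_prob_integrable. Qed.

Let iXXl m c (k : R) : (@beta_prob R m.+1 m.+1).-integrable `[0, 1]
  (EFin \o (fun x => k * XMonemX c c x)).
Proof.
rewrite [X in integrable _ _ X](_ : _ =
  (fun x => k%:E * (EFin \o XMonemX c c) x)%E).
  apply: integrableZl => //; exact: iXX.
by apply/funext => x /=; rewrite EFinM.
Qed.

Let mean0 m : \int[beta_prob m.+1 m.+1]_(x in `[0, 1]) XMonemX 0 0 x = 1 :> R.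
Proof.
by rewrite Rintegral_beta_XMonemX !addn0 divff// gt_eqF ?beta_fun_gt0.
Qed.

Let mean1 m : \int[beta_prob m.+1 m.+1]_(x in `[0, 1]) XMonemX 1 1 x =
  m.+1%:R / (2 * (2 * m + 3)%:R) :> R.
Proof. by rewrite Rintegral_beta_XMonemX !addn1 beta_funSS. Qed.

(** On the unit interval [(x - 1/2)^2 = 1/4 - x (1 - x)], so even central
    moments are combinations of ratios of Beta functions. *)
Lemma beta_second_moment m :
  \int[beta_prob m.+1 m.+1]_(x in `[0, 1]) ((x - 2^-1) ^+ 2) =
  (4 * (2 * m + 3)%:R)^-1 :> R.
Proof.
transitivity (\int[beta_prob m.+1 m.+1]_(x in `[0, 1])
   (4^-1 * XMonemX 0 0 x - XMonemX 1 1 x) : R).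
  apply: eq_Rintegral => x _; rewrite XMonemX00.
  by have -> : XMonemX 1 1 x = x * (1 - x) by []; field.
rewrite RintegralB//; [|exact: iXXl|exact: iXX].
rewrite RintegralZl//; last exact: iXX.
rewrite mean0 mean1.
have n0 : 0 <= m%:R :> R by [].
rewrite natrD natrM -[m.+1%:R]natr1; field.
by apply/eqP; lra.
Qed.

Lemma beta_fourth_moment m :
  \int[beta_prob m.+1 m.+1]_(x in `[0, 1]) ((x - 2^-1) ^+ 4) =
  3 / (16 * (2 * m + 3)%:R * (2 * m + 5)%:R) :> R.
Proof.
transitivity (\int[beta_prob m.+1 m.+1]_(x in `[0, 1])
   (16^-1 * XMonemX 0 0 x - 2^-1 * XMonemX 1 1 x + XMonemX 2 2 x) : R).
  apply: eq_Rintegral => x _; rewrite XMonemX00.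
  have -> : XMonemX 1 1 x = x * (1 - x) by [].
  by have -> : XMonemX 2 2 x = x ^+ 2 * (1 - x) ^+ 2 by []; field.
rewrite RintegralD//; [|  |exact: iXX]; last first.
  rewrite [X in integrable _ _ X](_ : _ =
    ((EFin \o (fun x => 16^-1 * XMonemX 0 0 x)%R) \-
     (EFin \o (fun x => 2^-1 * XMonemX 1 1 x)%R))%E).
    by apply: integrableB => //; exact: iXXl.
  by apply/funext => x /=; rewrite EFinB.
rewrite RintegralB//; [|exact: iXXl..].
rewrite (RintegralZl 16^-1)//; last exact: iXX.
rewrite (RintegralZl 2^-1)//; last exact: iXX.
rewrite mean0 mean1 Rintegral_beta_XMonemX !addn2.
have -> : beta_fun m.+3 m.+3 / beta_fun m.+1 m.+1 =
    (m.+2%:R / (2 * (2 * m.+1 + 3)%:R)) * (m.+1%:R / (2 * (2 * m + 3)%:R)) :> R.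
  by rewrite -!beta_funSS mulrA divfK// gt_eqF ?beta_fun_gt0.
have n0 : 0 <= m%:R :> R by [].
rewrite !natrD !natrM -[m.+2%:R]natr1 -[m.+1%:R]natr1; field.
by apply/andP; split; apply/eqP; lra.
Qed.

End BetaMoments.

(** * The binomial law and the Beta distribution function *)

(** The sum runs over the number [i] of failures in [n + 1] trials with success
    probability ['X]. Its derivative telescopes to a single monomial, the Beta
    density up to normalization. *)
Lemma deriv_binomial_head (R : comNzRingType) n j : (j <= n)%N ->
  (\sum_(i < j.+1) ((1 - 'X) ^+ i * 'X ^+ (n.+1 - i)) *+ 'C(n.+1, i))^`() =
  ((1 - 'X) ^+ j * 'X ^+ (n - j)) *+ (n.+1 * 'C(n, j)) :> {poly R}.
Proof.
elim: j => [_|j IH jn].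
  by rewrite big_ord1 subn0 expr0 mul1r bin0 mulr1n derivXn subn0 mul1r muln1.
rewrite big_ord_recr/= derivD IH ?(ltnW jn)// derivMn derivM deriv_exp derivXn.
rewrite derivB derivX derivC sub0r mulN1r/= subSS.
have -> : (n - j = (n - j.+1).+1)%N by rewrite subnSK.
rewrite !mulrnAl !mulrnAr mulrnDl -!mulrnA -mul_bin_diag mulNr mulNrn.
rewrite addrA subrr add0r.
by congr (_ *+ _); rewrite [RHS](mul_bin_down n.+1 j.+1) subSS subnSK.
Qed.

(** Both sides have the same derivative in [s] and vanish at [0]; the head of
    the binomial does because [j <= n] leaves a positive power of [s] in every
    term. *)
Lemma beta_cdf (R : realType) n j (s : R) : (j <= n)%N -> 0 <= s <= 1 ->
  (beta_prob (n - j).+1 j.+1 `]-oo, s] =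
   (\sum_(i < j.+1) ((1 - s) ^+ i * s ^+ (n.+1 - i)) *+ 'C(n.+1, i))%:E)%E.
Proof.
move=> jn /andP[s0 s1].
pose p : {poly R} :=
  \sum_(i < j.+1) ((1 - 'X) ^+ i * 'X ^+ (n.+1 - i)) *+ 'C(n.+1, i).
have pE x : p.[x] =
    \sum_(i < j.+1) ((1 - x) ^+ i * x ^+ (n.+1 - i)) *+ 'C(n.+1, i).
  by rewrite /p horner_sum; apply: eq_bigr => i _; rewrite hornerMn !hornerE.
have p0 : p.[0] = 0.
  rewrite pE big1// => i _; rewrite subSn; last first.
    by rewrite (leq_trans _ jn)// -ltnS.
  by rewrite exprS mul0r mulr0 mul0rn.
pose B := beta_fun (n - j).+1 j.+1 : R.
have B0 : B != 0 by rewrite gt_eqF ?beta_fun_gt0.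
have dp x : p^`().[x] = B^-1 * XMonemX (n - j) j x.
  rewrite deriv_binomial_head// hornerMn -[LHS]mulr_natl hornerM !horner_exp.
  rewrite hornerD hornerN hornerX hornerC [_ ^+ j * _]mulrC.
  congr (_ * _); rewrite /B beta_fun_fact subnK// invf_div.
  apply: (canRL (mulfK _)).
    by rewrite pnatr_eq0 muln_eq0 negb_or -!lt0n !fact_gt0.
  rewrite -natrM factS -(bin_fact jn) -mulnA; congr (_ * (_ * _))%:R.
  exact: mulnC.
rewrite -pE -integral_beta_pdf//.
transitivity (\int[lebesgue_measure]_(x in `[0%R, s]) (p^`().[x])%:E)%E.
  have -> : `[0, s]%classic = `]-oo, s] `&` `[0, 1].
    apply/seteqP; split => x /=; rewrite !in_itv/=.
      by move=> /andP[-> xs]; rewrite xs (le_trans xs).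
    by move=> [xs /andP[-> _]].
  rewrite integral_mkcondr; apply: eq_integral => x _.
  rewrite /beta_pdf restrict_EFin/= !patchE.
  by case: ifPn => _; rewrite ?mul0r// dp mulrC.
have [->|sn0] := eqVneq s 0.
  by rewrite p0 set_itv1 integral_set1.
have {}s0 : 0 < s by rewrite lt_def sn0.
rewrite (@continuous_FTC2 _ _ (horner p))//.
- by rewrite p0 sube0.
- by apply: continuous_subspaceT => x; exact: continuous_horner.
- split=> [x _||]; first exact: derivable_horner.
    by apply: cvg_at_right_filter; exact: continuous_horner.
  by apply: cvg_at_left_filter; exact: continuous_horner.
- by move=> x _; rewrite derivE.
Qed.

Section BinomialLaw.
Context d (Omega : measurableType d) (R : realType) (P : probability Omega R).

Lemma measure_preimage_finType (I : finType) (phi : Omega -> I) (D : pred I) :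
  (forall i, measurable (phi @^-1` [set i])) ->
  P [set w | D (phi w)] = (\sum_(i | D i) P (phi @^-1` [set i]))%E.
Proof.
move=> mphi.
have -> : [set w | D (phi w)] = \bigcup_(i in [set` D]) phi @^-1` [set i].
  by apply/seteqP; split => [w Dw|w [i Di /= ->]//]; exists (phi w).
rewrite measure_fin_bigcup//; last by move=> i k _ _ [w /= [-> ->]].
by rewrite (bigfs _ (r := index_enum I)) ?index_enum_uniq// => i _;
  rewrite mem_index_enum.
Qed.

Lemma sum_cards_le (n j : nat) (F : nat -> R) :
  \sum_(J : {set 'I_n} | (#|J| <= j)%N) F #|J| =
  \sum_(i < j.+1) F i *+ 'C(n, i).
Proof.
rewrite (partition_big (fun J : {set 'I_n} => inord #|J| : 'I_j.+1) xpredT)//=.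
apply: eq_bigr => i _.
rewrite (eq_bigl (fun J : {set 'I_n} => #|J| == i)); last first.
  move=> J /=; apply/andP/eqP => [[Jj /eqP <-]|Ji]; first by rewrite inordK.
  by rewrite Ji -ltnS; split=> //; apply/eqP/val_inj; rewrite /= inordK.
rewrite (eq_bigr (fun=> F i)); last by move=> J /eqP ->.
rewrite sumr_const; congr (_ *+ _).
by rewrite -[n in RHS]card_ord -card_draws cardsE.
Qed.

Variables (q : nat -> Omega -> bool) (p : R).
Hypothesis mq : forall i b, measurable (q i @^-1` [set b]).
Hypothesis indep_q : forall n (b : nat -> bool),
  P (\bigcap_(i in [set` iota 0 n]) (q i @^-1` [set b i])) =
  (\prod_(i <- iota 0 n) (if b i then p else 1 - p))%:E.

(** The event is split according to the set of indices that fail, each such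
    set having an explicit probability by independence. *)
Lemma binomial_law n j :
  P [set w | (\sum_(i < n) ~~ q i w <= j)%N] =
  (\sum_(i < j.+1) ((1 - p) ^+ i * p ^+ (n - i)) *+ 'C(n, i))%:E.
Proof.
pose phi w : {set 'I_n} := [set i : 'I_n | ~~ q i w]%SET.
pose b (J : {set 'I_n}) k := oapp (fun i => i \notin J) true (insub k).
have phiE J : phi @^-1` [set J] =
    \bigcap_(i in [set` iota 0 n]) (q i @^-1` [set b J i]).
  apply/seteqP; split => w /=.
    move=> <- k /=; rewrite mem_iota add0n => /= kn.
    by rewrite /b (insubT (fun k => (k < n)%N) kn)/= inE negbK.
  move=> H; apply/setP => i; rewrite inE.
  have /= -> := H i; first by rewrite /b valK/= negbK.
  by rewrite mem_iota add0n/=.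
have -> : [set w | (\sum_(i < n) ~~ q i w <= j)%N] =
    [set w | (#|phi w| <= j)%N].
  apply/funext => w; congr (is_true (_ <= _)%N).
    rewrite /phi cardsE -sum1_card [RHS]big_mkcond/=.
  by apply: eq_bigr => i _; rewrite unfold_in /=; case: (q i w).
rewrite (measure_preimage_finType (fun J : {set 'I_n} => #|J| <= j)%N);
  last first.
  move=> J; rewrite phiE; apply: fin_bigcap_measurable => // i _; exact: mq.
rewrite -(sum_cards_le n j (fun i => (1 - p) ^+ i * p ^+ (n - i))) -sumEFin.
apply: eq_bigr => J _; rewrite phiE indep_q; congr EFin.
have -> : iota 0 n = index_iota 0 n by rewrite /index_iota subn0.
rewrite big_mkord (eq_bigr (fun i => if i \in J then 1 - p else p)); last first.
  by move=> i _; rewrite /b valK/=; case: (i \in J).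
rewrite big_if/= !prodr_const; congr (_ * _ ^+ _).
rewrite -[X in (X - _)%N]card_ord -(cardC (mem J)) addKn.
by apply: eq_card => i; rewrite !inE.
Qed.

End BinomialLaw.

(** * Expansion of the survival function at 1/2 *)

Section TailExpansion.
Context (R : realType) (nu : probability R R) (f : R -> R).
Hypothesis nuf : has_density01 nu f.

Definition tail (v : R) : R := fine (nu `[v, +oo[%classic).

Lemma tail_itv v : 0 <= tail v <= 1.
Proof. exact: fine_probability_itv. Qed.

Lemma tailB a b : a <= b -> tail a - tail b = fine (nu `[a, b[%classic).
Proof.
move=> ab; have fin (A : set R) : measurable A -> nu A \is a fin_num.
  exact: fin_num_measure.
rewrite /tail.
have -> : `[a, +oo[%classic = `[a, b[ `|` `[b, +oo[.
  by rewrite -itv_bndbnd_setU// bnd_simp.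
rewrite measureU// ?fineD ?fin//; first by rewrite addrK.
apply/seteqP; split => x //=; rewrite !in_itv/= andbT => -[/andP[_ xb] bx].
by have := lt_le_trans xb bx; rewrite ltxx.
Qed.

(** Stated with a bound [M] on [f] over the interval only, since [f] is
    controlled near 1/2 and nowhere else. *)
Lemma itv_prob_le a b M : a <= b -> 0 <= a -> b <= 1 -> 0 <= M ->
  (forall s, a <= s < b -> f s <= M) ->
  fine (nu `[a, b[%classic) <= M * (b - a).
Proof.
move=> ab a0 b1 M0 fM; have [mf f0 dens] := nuf.
have sub01 : (`[a, b[ : set R) `<=` `[0, 1].
  move=> x /=; rewrite !in_itv/= => /andP[ax xb].
  by rewrite (le_trans a0 ax) (le_trans (ltW xb) b1).
have <- : fine (M * (b - a))%:E = M * (b - a) by [].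
apply: fine_le => //; first exact: fin_num_measure.
rewrite dens// setIidl//.
apply: (@le_trans _ _ (\int[lebesgue_measure]_(s in `[a, b[) M%:E)%E).
  apply: ge0_le_integral => //.
  - by move=> x /sub01/= x01; rewrite lee_fin f0// -in_itv.
  - by apply/measurable_EFinP; exact: measurable_funS mf.
rewrite integral_cst//= lebesgue_measure_itv/= lte_fin.
case: ifPn => [_|]; first by rewrite -EFinB -EFinM lexx.
by rewrite mule0 lee_fin mulr_ge0// subr_ge0.
Qed.

(** Within distance [e] of 1/2 the density is at most
    [f (1/2) + kappa * `|v - 1/2|] between 1/2 and [v]; farther away the left
    side is at most 1, which [(v - 1/2)^2 / e^2] exceeds. Hence
    [K = kappa + 1 / e^2], and the bound holds for all [v]. *)
Lemma tail_expansion : lipschitz_near_half f -> exists2 K : R, 0 <= K &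
  forall v, `|tail v - tail 2^-1| <= f 2^-1 * `|v - 2^-1| + K * (v - 2^-1) ^+ 2.
Proof.
move=> [kappa [delta [kappa0 delta0 lip]]]; have [mf f0 dens] := nuf.
(* The cap 1/2 keeps the interval inside [0, 1], where the density lives. *)
pose e := Num.min delta 2^-1.
have e0 : 0 < e by rewrite lt_min delta0/=.
have [ed e2] : e <= delta /\ e <= 2^-1 by rewrite !ge_min !lexx orbT.
have f2 : 0 <= f 2^-1 by apply: f0; lra.
exists (kappa + (e ^+ 2)^-1) => [|v].
  by rewrite addr_ge0 ?ltW// invr_gt0 exprn_gt0.
have [far|near] := ltP e `|v - 2^-1|.
  have ge1 : 1 <= (e ^+ 2)^-1 * (v - 2^-1) ^+ 2.
    rewrite mulrC ler_pdivlMr ?exprn_gt0// mul1r -[leRHS]real_normK ?num_real//.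
    by rewrite ler_sqr ?nnegrE// ltW.
  apply: (@le_trans _ _ 1).
    have /andP[? ?] := tail_itv v; have /andP[? ?] := tail_itv 2^-1.
    by rewrite ler_norml; lra.
  have fy : 0 <= f 2^-1 * `|v - 2^-1| by rewrite mulr_ge0.
  have ky : 0 <= kappa * (v - 2^-1) ^+ 2 by rewrite mulr_ge0 ?sqr_ge0// ltW.
  by rewrite mulrDl; lra.
have ey : 0 <= (e ^+ 2)^-1 * (v - 2^-1) ^+ 2.
  by rewrite mulr_ge0 ?sqr_ge0// invr_ge0 exprn_ge0// ltW.
have incr a b : a <= b -> a = 2^-1 \/ b = 2^-1 -> b - a <= e ->
    0 <= tail a - tail b <= f 2^-1 * (b - a) + kappa * (b - a) ^+ 2.
  move=> ab mid be; rewrite tailB//.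
  have mab : measurable (`[a, b[ : set R) by [].
  have [a0 b1] : 0 <= a /\ b <= 1 by case: mid => ?; lra.
  have /andP[-> _] := fine_probability_itv nu mab.
  have ba0 : 0 <= b - a by rewrite subr_ge0.
  have kb0 : 0 <= kappa * (b - a) by rewrite mulr_ge0// ltW.
  rewrite /= expr2 mulrA -mulrDl; apply: itv_prob_le => //.
    by rewrite addr_ge0.
  move=> s /andP[sa sb]; rewrite -lerBlDl.
  apply: (@le_trans _ _ (kappa * `|s - 2^-1|)).
    by rewrite (le_trans (ler_norm _))// lip//; case: mid => ?; lra.
  by rewrite ler_pM2l// ler_norml; case: mid => ?; lra.
have [v2|v2] := leP v 2^-1.
  rewrite [`|v - _|]ler0_norm ?subr_le0// in near *.
  have /andP[d0 d1] := incr v 2^-1 v2 (or_intror erefl) ltac:(lra).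
  rewrite ger0_norm// (le_trans d1)// -sqrrN !opprB mulrDl; lra.
rewrite [`|v - _|]gtr0_norm ?subr_gt0// in near *.
have /andP[d0 d1] := incr 2^-1 v (ltW v2) (or_introl erefl) near.
rewrite distrC ger0_norm// (le_trans d1)// mulrDl; lra.
Qed.

End TailExpansion.

(** * Variance of the survival function at a Beta variable *)

Lemma Rintegral_beta_prob01 (R : realType) a b (h : R -> R) :
  (beta_prob a b).-integrable setT (EFin \o h) ->
  \int[beta_prob a b]_x h x = \int[beta_prob a b]_(x in `[0, 1]) h x.
Proof.
move=> ih; rewrite /Rintegral; congr fine.
have mI : measurable (~` `[0%R, 1%R]%classic : set (measurableTypeR R)).
  exact: measurableC.
have nullI :
    beta_prob a b (~` `[0%R, 1%R]%classic : set (measurableTypeR R)) = 0%E.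
  by rewrite probability_setC//= beta_prob01 subee.
rewrite (negligible_integral mI measurableT ih nullI).
by rewrite setDE setCK setTI.
Qed.

(** Young's inequality in the form that keeps the constant in front of [a ^+ 2]
    arbitrarily close to 1. *)
Lemma sqr_le_young (R : realFieldType) (z a b eta : R) : 0 < eta ->
  `|z| <= a + b -> 0 <= a -> 0 <= b ->
  z ^+ 2 <= (1 + eta) * a ^+ 2 + (1 + eta^-1) * b ^+ 2.
Proof.
move=> eta0 zab a0 b0.
have -> : (1 + eta) * a ^+ 2 + (1 + eta^-1) * b ^+ 2 =
    (a + b) ^+ 2 + eta^-1 * (eta * a - b) ^+ 2.
  by field; rewrite gt_eqF.
rewrite -[leLHS]real_normK ?num_real// -[leLHS]addr0 lerD//.
  by rewrite ler_sqr ?nnegrE// addr_ge0.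
by rewrite mulr_ge0 ?sqr_ge0// invr_ge0 ltW.
Qed.

Lemma measurable_tail (R : realType) (nu : probability R R) :
  measurable_fun setT (tail nu).
Proof.
apply: (@nonincreasing_measurable R setT) => // x y xy.
rewrite /tail fine_le//; [exact: fin_num_measure..|].
apply: le_measure; rewrite ?inE// => z /=.
by rewrite !in_itv/= !andbT; exact: le_trans.
Qed.

Lemma integrable_beta_centered_exp (R : realType) a b k :
  (@beta_prob R a b).-integrable `[0, 1] (EFin \o (fun x => (x - 2^-1) ^+ k)).
Proof.
apply: measurable_bounded_integrable => //.
- by rewrite -ge0_fin_numE// fin_num_measure.
- by apply: measurable_funX; exact: measurable_funB.
- exists 1; split => // M M1 x /=; rewrite in_itv/= => /andP[x0 x1].
  rewrite (le_trans _ (ltW M1))// normrX exprn_ile1// ler_norml.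
  by lra.
Qed.

(** The parameter [eta] is left free: it weighs the exact constant of the
    leading term against the size of the remainder. *)
Lemma var_tail_beta (R : realType) (nu : probability R R) (f : R -> R) :
  has_density01 nu f -> lipschitz_near_half f -> exists2 K : R, 0 <= K &
  forall m eta, 0 < eta ->
  var (beta_prob m.+1 m.+1) (tail nu) <=
  (1 + eta) * f 2^-1 ^+ 2 * (4 * (2 * m + 3)%:R)^-1 +
  (1 + eta^-1) * K ^+ 2 * (3 / (16 * (2 * m + 3)%:R * (2 * m + 5)%:R)).
Proof.
move=> nuf lipf; have [K K0 HK] := tail_expansion nuf lipf.
exists K => // m eta eta0.
have mt := measurable_tail nu.
set A := (1 + eta) * f 2^-1 ^+ 2; set B := (1 + eta^-1) * K ^+ 2.
have iZ c k : (@beta_prob R m.+1 m.+1).-integrable `[0, 1]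
    (EFin \o (fun x => c * (x - 2^-1) ^+ k)).
  rewrite [X in integrable _ _ X](_ : _ =
    (fun x => c%:E * (EFin \o (fun x => (x - 2^-1) ^+ k)%R) x)%E).
    by apply: integrableZl => //; exact: integrable_beta_centered_exp.
  by apply/funext => x /=; rewrite EFinM.
rewrite -beta_second_moment -beta_fourth_moment.
rewrite -RintegralZl//; last exact: integrable_beta_centered_exp.
rewrite -(RintegralZl B)//; last exact: integrable_beta_centered_exp.
rewrite -RintegralD//.
have centered := @var_le_sqrB _ _ R (beta_prob m.+1 m.+1) _ mt (tail_itv nu)
  (tail nu 2^-1).
apply: le_trans centered _.
have isq : (@beta_prob R m.+1 m.+1).-integrable setT
    (EFin \o (fun x => (tail nu x - tail nu 2^-1) ^+ 2)).
  apply: integrable_le1 => [|x].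
    by apply: measurable_funX; exact: measurable_funB.
  have /andP[? ?] := tail_itv nu x; have /andP[? ?] := tail_itv nu 2^-1.
  by rewrite normrX exprn_ile1// ler_norml; lra.
rewrite Rintegral_beta_prob01//; apply: le_Rintegral => //.
- by apply: integrableS isq.
- rewrite [X in integrable _ _ X](_ : _ =
    ((EFin \o (fun x => A * (x - 2^-1) ^+ 2)%R) \+
     (EFin \o (fun x => B * (x - 2^-1) ^+ 4)%R))%E).
    exact: integrableD.
  by apply/funext => x /=; rewrite EFinD.
move=> x _.
have -> : A * (x - 2^-1) ^+ 2 + B * (x - 2^-1) ^+ 4 =
    (1 + eta) * (f 2^-1 * `|x - 2^-1|) ^+ 2 +
    (1 + eta^-1) * (K * (x - 2^-1) ^+ 2) ^+ 2.
  by rewrite !exprMn real_normK ?num_real// /A /B; ring.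
apply: sqr_le_young => //; last by rewrite mulr_ge0 ?sqr_ge0.
rewrite mulr_ge0//; have [_ f0 _] := nuf; apply: f0; lra.
Qed.

(** * Majority votes *)

Section MajorityVariance.
Context d (Omega : measurableType d) (R : realType) (P : probability Omega R).
Context d' (T : measurableType d') (mu : probability T R).
Variables (q : nat -> Omega -> T -> bool) (theta : T -> R).
Hypothesis mq : forall i,
  measurable_fun setT (fun p : Omega * T => q i p.1 p.2).
Hypothesis mtheta : measurable_fun setT theta.
Hypothesis theta01 : forall x, 0 <= theta x <= 1.
Hypothesis bernoulli_q : forall x n (b : nat -> bool),
  P (\bigcap_(i in [set` iota 0 n]) [set w | q i w x = b i]) =
  (\prod_(i <- iota 0 n) (if b i then theta x else 1 - theta x))%:E.

(** For [n = 2 m + 1] this is the event that the majority of the votes is 1.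
    Counting the votes for 0 matches the way [deriv_binomial_head] sums. *)
Definition few_failures n m : set (Omega * T) :=
  [set p | (\sum_(i < n) ~~ q i p.1 p.2 <= m)%N].

Lemma measurable_few_failures n m : measurable (few_failures n m).
Proof.
have sumE p : \sum_(i < n) (if q i p.1 p.2 then 0 else 1) =
    (\sum_(i < n) ~~ q i p.1 p.2)%:R :> R.
  by rewrite natr_sum; apply: eq_bigr => i _; case: q.
have -> : few_failures n m = setT `&`
    [set p : Omega * T |
      \sum_(i < n) (if q i p.1 p.2 then 0 else 1) <= m%:R :> R].
  by rewrite setTI; apply/funext => p; rewrite /few_failures/= sumE ler_nat.
apply: measurable_fun_le => //.
by apply: measurable_sum => i; apply: measurable_fun_ifT.
Qed.

(** The probability that the majority is 1 equals the probability that the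
    median of [2 m + 1] uniform variables is at most [theta x]. *)
Lemma few_failures_beta m x :
  P (ysection (few_failures (2 * m).+1 m) x) =
  (beta_prob m.+1 m.+1 `]-oo, theta x])%E.
Proof.
have mqx i b : measurable ((fun w => q i w x) @^-1` [set b]).
  rewrite -[X in measurable X]setTI.
  have := measurableT_comp (mq i) (pair2_measurable x).
  by apply.
rewrite ysectionE.
have := binomial_law mqx (bernoulli_q x) (2 * m).+1 m => ->.
rewrite -(beta_cdf _ (theta01 x)); last by rewrite mul2n -addnn leq_addl.
by rewrite mul2n -addnn addnK.
Qed.

(** The coupling is with the half-lines [v <= theta x], nested because the line
    is totally ordered; their measure is the survival function of [theta]. *)
Lemma var_majority_le (nu : probability R R) m :
  (forall v, mu [set x | v <= theta x] = nu `[v, +oo[%classic) ->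
  var P (fun w => fine (mu (xsection (few_failures (2 * m).+1 m) w))) <=
  var (beta_prob m.+1 m.+1) (tail nu).
Proof.
move=> munu.
pose C : set (R * T) := [set p | p.1 <= theta p.2].
have mC : measurable C.
  rewrite -[C]setTI; apply: measurable_fun_le => //.
  exact: measurableT_comp.
have yC x : ysection C x = `]-oo, theta x]%classic.
  by apply/seteqP; split => v; rewrite ysectionE /= in_itv.
have -> : tail nu = fun v => fine (mu (xsection C v)).
  apply/funext => v; rewrite /tail -munu; congr (fine (mu _)).
  by apply/seteqP; split => x; rewrite xsectionE.
apply: var_xsection_le => //.
- exact: measurable_few_failures.
- by move=> x; rewrite few_failures_beta yC.
move=> x x'; rewrite !yC.
have [xx'|/ltW xx'] := leP (theta x) (theta x'); [left|right] => v /=;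
  rewrite !in_itv/= => /le_trans; exact.
Qed.

End MajorityVariance.

(** An odd number of votes leaves no tie, so the error set for [l = 1] is the
    exact complement of the one for [l = 0]. *)
Lemma Err_few_failures d (Omega : measurableType d) (R : realType) d'
    (T : measurableType d') (mu : probability T R)
    (q : nat -> Omega -> T -> bool) (l : bool) m w :
  measurable (xsection (few_failures q (2 * m).+1 m) w) ->
  Err q mu l (2 * m).+1 w =
  let z := fine (mu (xsection (few_failures q (2 * m).+1 m) w)) in
  if l then 1 - z else z.
Proof.
move=> mS /=; set t := (2 * m).+1; set S := xsection _ _ in mS *.
have -> : Err q mu l t w = fine (mu (if l then ~` S else S)).
  have E : [set x | `|Qbar R q t w x - l%:R| >= 2^-1] = if l then ~` S else S.
    apply/funext => x; set F := (\sum_(i < t) ~~ q i w x)%N.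
    have SE : S x = (F <= m)%N by rewrite /S xsectionE.
    have Ft : (F <= t)%N.
      rewrite -[leqRHS](card_ord t) -sum1_card; apply: leq_sum => i _.
      by case: (q i w x).
    have t0 : 0 < t%:R :> R by rewrite ltr0n.
    have QE : Qbar R q t w x = 1 - F%:R / t%:R.
      rewrite /Qbar; have -> : \sum_(i < t) (q i w x)%:R = t%:R - F%:R :> R.
        have -> : t%:R = \sum_(i < t) 1 :> R by rewrite sumr_const card_ord.
        rewrite /F natr_sum -sumrB.
        by apply: eq_bigr => i _; case: (q i w x); rewrite ?subr0 ?subrr.
      by field; rewrite gt_eqF.
    have F1 : 0 <= (F%:R / t%:R : R) <= 1.
      by rewrite divr_ge0//= ler_pdivrMr// mul1r ler_nat.
    have FmE : (F <= m)%N = ((F%:R / t%:R : R) <= 2^-1).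
      rewrite ler_pdivrMr// -(ler_pM2l (ltr0n R 2)) mulrA divff// mul1r.
      by rewrite -natrM ler_nat /t; lia.
    have FmE' : ~~ (F <= m)%N = (2^-1 <= (F%:R / t%:R : R)).
      rewrite ler_pdivlMr// -(ler_pM2l (ltr0n R 2)) mulrA divff// mul1r.
      by rewrite -natrM ler_nat /t; lia.
    case: l => /=.
      rewrite SE QE addrAC subrr add0r normrN ger0_norm; last by case/andP: F1.
      by rewrite -FmE'; apply/propext; split => /negP.
    by rewrite SE QE subr0 ger0_norm ?FmE; [apply/propext; split; lra | lra].
  rewrite /Err E /Rintegral; congr fine; rewrite integral_indic ?setIT//.
  by case: l {E} => //; exact: measurableC.
case: l => //; rewrite probability_setC// fineB//.
by rewrite fin_num_measure.
Qed.

(** * The remainder *)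

Lemma invr_mul_sqrt_littleo (R : realType) (c : R) :
  (fun t : nat => c / (t%:R * Num.sqrt t%:R)) =o_\oo
  (fun t : nat => (t%:R : R)^-1).
Proof.
apply/eqoP => e e0; near=> t.
have t1 : 1 <= t%:R :> R by near: t; exact: nbhs_infty_ger.
have t0 : 0 < t%:R :> R by exact: lt_le_trans t1.
have ct : (`|c| / e) ^+ 2 <= t%:R by near: t; exact: nbhs_infty_ger.
have s0 : 0 < Num.sqrt (t%:R : R) by rewrite sqrtr_gt0.
have cs : `|c| / e <= Num.sqrt t%:R.
  by rewrite -ler_sqr ?nnegrE ?sqr_sqrtr ?divr_ge0// ltW.
rewrite normrM normfV (gtr0_norm (mulr_gt0 t0 s0)) normfV (gtr0_norm t0).
rewrite invfM mulrCA mulrC ler_pM2r ?invr_gt0//.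
by rewrite ler_pdivrMr// mulrC -ler_pdivrMr.
Unshelve. all: by end_near. Qed.

(** With [eta = t ^ (-1/2)] the excess of the second-moment term and the whole
    fourth-moment term are both of order [t ^ (-3/2)]. *)
Lemma beta_bound_rate (R : rcfType) m (a k : R) :
  let t := (2 * m).+1%:R : R in let eta := (Num.sqrt t)^-1 in
  0 <= a -> 0 <= k ->
  (1 + eta) * a * (4 * (2 * m + 3)%:R)^-1 +
  (1 + eta^-1) * k * (3 / (16 * (2 * m + 3)%:R * (2 * m + 5)%:R)) <=
  1 / (4 * t) * a + (a / 4 + 3 / 8 * k) / (t * Num.sqrt t).
Proof.
move=> t eta a0 k0.
have t1 : 1 <= t by rewrite ler1n.
have t0 : 0 < t by exact: lt_le_trans t1.
have t3 : t <= (2 * m + 3)%:R by rewrite ler_nat; lia.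
have t5 : t <= (2 * m + 5)%:R by rewrite ler_nat; lia.
have t30 := lt_le_trans t0 t3; have t50 := lt_le_trans t0 t5.
set s := Num.sqrt t in eta *.
have s1 : 1 <= s by rewrite -[leLHS]sqrtr1 ler_wsqrtr.
have s0 : 0 < s by exact: lt_le_trans s1.
have st : s ^+ 2 = t by rewrite sqr_sqrtr// ltW.
rewrite /eta invrK.
have first : (1 + s^-1) * a * (4 * (2 * m + 3)%:R)^-1 <=
    1 / (4 * t) * a + a / 4 / (t * s).
  have -> : 1 / (4 * t) * a + a / 4 / (t * s) = (1 + s^-1) * a * (4 * t)^-1.
    by field; rewrite !gt_eqF.
  rewrite ler_wpM2l//; first by rewrite mulr_ge0// addr_ge0// invr_ge0 ltW.
  by rewrite lef_pV2 ?posrE ?mulr_gt0// ?ler_pM2l.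
have second : (1 + s) * k * (3 / (16 * (2 * m + 3)%:R * (2 * m + 5)%:R)) <=
    3 / 8 * k / (t * s).
  apply: (@le_trans _ _ ((s + s) * k * (3 / (16 * t * t)))); last first.
    by rewrite le_eqVlt -st; apply/orP; left; apply/eqP; field; rewrite gt_eqF.
  apply: ler_pM.
  - by rewrite mulr_ge0// addr_ge0// ltW.
  - by rewrite divr_ge0// !mulr_ge0.
  - by rewrite ler_wpM2r// lerD2r.
  rewrite ler_pM2l// lef_pV2 ?posrE ?mulr_gt0//.
  apply: ler_pM; [by rewrite mulr_ge0// ltW|exact: ltW| |exact: t5].
  by rewrite ler_pM2l// ltr0n.
by rewrite [(a / 4 + _) / _]mulrDl addrA; exact: lerD.
Qed.

Theorem theorem1 (R : realType)
  (dO : measure_display) (Omega : measurableType dO) (P : probability Omega R)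
  (dT : measure_display) (T : measurableType dT)
  (dS : measure_display) (U : measurableType dS)
  (n : nat) (D : n.-tuple (T * bool))
  (X : {RV P >-> T}) (Y : {RV P >-> bool})
  (hY : forall l' : bool, (0 < P (Y @^-1` [set l']))%E)
  (g : T -> n.-tuple (T * bool) -> U -> bool)
  (hg : measurable_fun setT (fun p : T * U => g p.1 D p.2))
  (xi : nat -> {RV P >-> U})
  (xi_indep : mutually_independent P (fun i => xi i : Omega -> U))
  (xi_id : identically_distributed P (fun i => xi i : Omega -> U))
  (XY_xi : indep_systems P (sigma_of (fun w => (X w, Y w)))
                           (sigma_of_seq (fun i => xi i : Omega -> U)))
  (Q : nat -> Omega -> T -> bool)
  (hQ : forall i w x, Q i w x = g x D (xi i w))
  (f : bool -> R -> R)
  (hf : forall l' : bool,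
     has_density01 (pushforward (cond_prob Y l') (theta P Q \o X)) (f l') /\
     lipschitz_near_half (f l'))
  (l : bool) :
  exists r : nat -> R, r =o_\oo (fun t : nat => (t%:R : R)^-1) /\
    forall t : nat, odd t ->
      var P (Err Q (cond_law X Y l) l t) <=
        1 / (4 * t%:R) * (f l 2^-1) ^+ 2 + r t.
Proof.
pose mu := cond_law X Y l.
have mQ i : measurable_fun setT (fun p : Omega * T => Q i p.1 p.2).
  rewrite (_ : (fun _ => _) =
    (fun q : T * U => g q.1 D q.2) \o (fun p : Omega * T => (p.2, xi i p.1))).
    apply: measurableT_comp => //; apply: measurable_fun_pair => //.
    exact: measurableT_comp.
  by apply/funext => p /=; rewrite hQ.
pose S0 := [set p : Omega * T | Q 0 p.1 p.2].
have mS0 : measurable S0.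
  have := mQ 0%N measurableT [set true] I; rewrite setTI.
  by congr measurable; apply/funext => p /=; apply/propext; split.
have thetaE : theta P Q = fun x => fine (P (ysection S0 x)).
  apply/funext => x; rewrite /theta unlock; congr fine.
  rewrite -[X in P X]setIT -integral_indic//; last exact: measurable_ysection.
  apply: eq_integral => w _; rewrite indicE ysectionE; congr (_%:R)%:E.
  by rewrite mem_setE.
have mtheta : measurable_fun setT (theta P Q).
  by rewrite thetaE; exact: measurable_fine_ysection.
have theta01 x : 0 <= theta P Q x <= 1.
  by rewrite thetaE; apply: fine_probability_itv; exact: measurable_ysection.
have mgx x b : measurable [set u | g x D u = b].
  have mgx : measurable_fun setT (fun u => g x D u).
    exact: (measurableT_comp hg (pair1_measurable x)).
  by have := mgx measurableT [set b] I; rewrite setTI.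
have bernoulliQ x k (b : nat -> bool) :
    P (\bigcap_(i in [set` iota 0 k]) [set w | Q i w x = b i]) =
    (\prod_(i <- iota 0 k) (if b i then theta P Q x else 1 - theta P Q x))%:E.
  have := xi_indep (iota 0 k) (fun i => [set u | g x D u = b i]) (iota_uniq 0 k)
    (fun i => mgx x (b i)).
  rewrite (_ : \bigcap_(i in _) _ =
    \bigcap_(i in [set` iota 0 k]) [set w | Q i w x = b i]); last first.
    by apply: eq_bigcapr => i _; apply/funext => w /=; rewrite hQ.
  move=> ->; rewrite -prodEFin; apply: eq_bigr => i _.
  rewrite (xi_id i 0%N)//.
  have P0 : P (xi 0%N @^-1` [set u | g x D u = true]) = (theta P Q x)%:E.
    rewrite thetaE fineK ?fin_num_measure//; last exact: measurable_ysection.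
    by congr (P _); rewrite ysectionE; apply/funext => w; rewrite /S0 /= hQ.
  case: (b i) => //.
  rewrite EFinB -P0 -probability_setC; last first.
    by rewrite -[X in measurable X]setTI; exact: measurable_funP.
  congr (P _); apply/funext => w /=; apply/propext.
  by case: (g x D _); split.
have [dens lip] := hf l.
pose thetaX : {mfun Omega >-> R} :=
  mfun_Sub (mem_set (measurableT_comp mtheta (measurable_funP X))).
pose nu : probability R R := distribution (cond_prob Y l) thetaX.
have [K K0 HK] := @var_tail_beta R nu (f l) dens lip.
exists (fun t => (f l 2^-1 ^+ 2 / 4 + 3 / 8 * K ^+ 2) / (t%:R * Num.sqrt t%:R)).
split; first exact: invr_mul_sqrt_littleo.
move=> t todd; have [m ->] : exists m, t = (2 * m).+1.
  by exists t./2; rewrite -[LHS]odd_double_half todd mul2n.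
pose Z w := fine (mu (xsection (few_failures Q (2 * m).+1 m) w)).
have mS : measurable (few_failures Q (2 * m).+1 m).
  exact: measurable_few_failures.
have -> : var P (Err Q mu l (2 * m).+1) = var P Z.
  have -> : Err Q mu l (2 * m).+1 = fun w => if l then 1 - Z w else Z w.
    by apply/funext => w; apply: Err_few_failures; exact: measurable_xsection.
  case: (l) => //; apply: var_onem; first exact: measurable_fine_xsection.
  by move=> w; apply: fine_probability_itv; exact: measurable_xsection.
have munu v : mu [set x | v <= theta P Q x] = nu `[v, +oo[%classic.
  rewrite /mu /cond_law /nu /distribution /pushforward/=.
  by congr (cond_prob Y l _); apply/funext => w; rewrite /= in_itv/= andbT.
apply: le_trans (var_majority_le mQ mtheta theta01 bernoulliQ m munu) _.
apply: le_trans (HK m (Num.sqrt (2 * m).+1%:R)^-1 _) _.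
  by rewrite invr_gt0 sqrtr_gt0 ltr0n.
by apply: beta_bound_rate; rewrite sqr_ge0.
Qed.
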